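(* Let $N\ge 2$ be even, let $\sigma>0$, let $d$ be the diffusion coefficient on $\Omega=[0,1]$ (periodic), and let $$\mathbf{A}_h=\sigma\,\mathbf{D}^2,\qquad \mathbf{B}_h=\mathbf{D}\,\big(\mathrm{diag}(\mathbf{d})-\sigma \mathbf{I}\big)\,\mathbf{D}$$ be the $N\times N$ matrices built from the spectral differentiation matrix $\mathbf{D}$ and the vector $\mathbf{d}=(d(x_1),\dots,d(x_N))^T$. Then: (1) The set $W_1(\mathbf{A}_h,\mathbf{B}_h)$ is contained in $\mathbb{R}$, and every $w\in W_1(\mathbf{A}_h,\mathbf{B}_h)$ satisfies $$1-\sigma^{-1}d_{\min}\;\ge\; w\;\ge\; 1-\sigma^{-1}d_{\max}.$$ (2) All elements of $\Lambda(\mathbf{A}_h,\mathbf{B}_h)$ are real, and $\mu_{\min}=\min\Lambda(\mathbf{A}_h,\mathbf{B}_h)$ and $\mu_{\max}=\max\Lambda(\mathbf{A}_h,\mathbf{B}_h)$ satisfy $$1-\sigma^{-1}d_{\max}\le \mu_{\min}\le 1-\sigma^{-1}d_{2,\min}^{\,*},\qquad 1-\sigma^{-1}d_{2,\min}\le \mu_{\max}\le 1-\sigma^{-1}d_{\min},$$ where $d_{2,\min}^{\,*}:=d_{2,\max}$ is the second largest entry of $\mathbf{d}$ and $d_{2,\min}$ is the second smallest entry of $\mathbf{d}$.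
   Context: Grid: $N$ is an even positive integer, $h=1/N$, $x_j=jh$ for $1\le j\le N$. The diffusion coefficient $d$ is a periodic function on $\Omega=[0,1]$ with $d(x)>0$ for all $x$, attaining its minimum and maximum; set $d_{\min}=\min_{x\in\Omega}d(x)$ and $d_{\max}=\max_{x\in\Omega}d(x)$. Let $\mathbf{d}=(d(x_1),\dots,d(x_N))^T$; $d_{2,\min}$ denotes the second smallest entry of $\mathbf{d}$ and $d_{2,\max}$ the second largest entry of $\mathbf{d}$ (entries counted with multiplicity, so that $d_{2,\min}=d_{2,\max}=d_0$ if all entries of $\mathbf{d}$ equal $d_0$). Matrices: $\mathrm{diag}(\mathbf{v})$ is the diagonal matrix with diagonal $\mathbf{v}$, and $\mathbf{I}$ is the $N\times N$ identity. The discrete Fourier matrix $\mathbf{F}$ has entries $\mathbf{F}_{j\ell}=\omega^{(j-1)(\ell-1)}$, $1\le j,\ell\le N$, with $\omega=e^{-2\pi i/N}$. The spectral differentiation matrix is $\mathbf{D}=i\,\mathbf{F}^{-1}\mathrm{diag}(\xi_1,\dots,\xi_N)\,\mathbf{F}$, where $$\xi_j=2\pi(j-1)\ \text{ if } 1\le j\le N/2,\qquad \xi_j=N\pi\ \text{ if } j=N/2+1,\qquad \xi_j=2\pi(j-1-N)\ \text{ if } N/2+1<j\le N.$$ Inner product: $\langle\mathbf{x},\mathbf{y}\rangle=\sum_{j=1}^N\overline{x_j}\,y_j$ on $\mathbb{C}^N$. Let $\mathbf{1}=(1,\dots,1)^T$ and $\mathbb{V}=\{\mathbf{u}\in\mathbb{C}^N:\mathbf{1}^T\mathbf{u}=0\}$.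 The matrix $\mathbf{A}_h$ is singular on $\mathbb{C}^N$ (its null space is $\mathrm{span}\{\mathbf{1}\}$), so the following sets are defined using only vectors in $\mathbb{V}$: $$W_1(\mathbf{A}_h,\mathbf{B}_h)=\big\{\langle\mathbf{x},\mathbf{B}_h\mathbf{x}\rangle:\ \mathbf{x}\in\mathbb{V},\ \langle\mathbf{x},(-\mathbf{A}_h)\mathbf{x}\rangle=1\big\},$$ $$\Lambda(\mathbf{A}_h,\mathbf{B}_h)=\big\{\mu\in\mathbb{C}:\ -\mu\,\mathbf{A}_h\mathbf{v}=\mathbf{B}_h\mathbf{v}\ \text{ for some } \mathbf{v}\in\mathbb{V},\ \mathbf{v}\ne\mathbf{0}\big\}.$$ *)

(* Defs.v *)
From HB Require Import structures.
From mathcomp Require Export all_boot all_order all_algebra complex.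
From mathcomp Require Export all_classical all_reals all_analysis.

Set Implicit Arguments.
Unset Strict Implicit.
Unset Printing Implicit Defensive.

Import Order.TTheory GRing.Theory Num.Theory.

Local Open Scope classical_set_scope.
Local Open Scope complex_scope.
Local Open Scope ring_scope.

(* The index sets 1 .. N of the mathematical text become 'I_N = {0, .., N-1},
   so an index j of the text is j = i + 1 with i : 'I_N. *)

(* On R[i] the order is the partial one, x <= y iff y - x is a nonnegative
   real, so a minimum or maximum is in particular comparable to all of S. *)
Definition is_min d (T : porderType d) (S : set T) (m : T) : Prop :=
  S m /\ lbound S m.
Definition is_max d (T : porderType d) (S : set T) (m : T) : Prop :=
  S m /\ ubound S m.

(* Counted with multiplicity; meaningful for size s >= 2. *)
Definition second_smallest (R : realType) (s : seq R) : R :=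
  nth 0 (sort <=%R s) 1.
Definition second_largest (R : realType) (s : seq R) : R :=
  nth 0 (sort >=%R s) 1.

Section Matrices.
Context {R : realType} (N : nat).
Local Notation C := R[i].

(* The exponential exp (i t), by Euler's formula. *)
Definition cis (t : R) : C := cos t +i* sin t.

Definition grid (i : 'I_N) : R := i.+1%:R / N%:R.

Definition sample (d : R -> R) : 'rV[R]_N := \row_i d (grid i).

Definition entries (v : 'rV[R]_N) : seq R := [seq v 0 i | i : 'I_N].

Definition diagC (v : 'rV[R]_N) : 'M[C]_N :=
  diag_mx (map_mx (fun r : R => r%:C) v).

Definition dft : 'M[C]_N :=
  \matrix_(j, l) cis (- (2 * pi / N%:R)) ^+ (j * l).

Definition xi : 'rV[R]_N :=
  \row_(i < N) (if (i < N./2)%N then 2 * pi * i%:R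
                else if i == N./2 :> nat then N%:R * pi
                else 2 * pi * (i%:R - N%:R)).

Definition specD : 'M[C]_N := 'i *: (invmx dft *m diagC xi *m dft).

Definition Ah (sigma : R) : 'M[C]_N := sigma%:C *: (specD *m specD).

Definition Bh (sigma : R) (d : R -> R) : 'M[C]_N :=
  specD *m (diagC (sample d) - (sigma%:C)%:M) *m specD.

Definition inner (x y : 'cV[C]_N) : C := \sum_i (x i 0)^* * y i 0.

Definition ones : 'cV[C]_N := const_mx 1.

Definition VV : set 'cV[C]_N := [set u | ones^T *m u = 0].

Definition W1 (A B : 'M[C]_N) : set C :=
  [set inner x (B *m x) | x in [set x | VV x /\ inner x (- A *m x) = 1]].

Definition Lambda (A B : 'M[C]_N) : set C :=
  [set mu | exists v, [/\ VV v, v != 0 & - mu *: (A *m v) = B *m v]].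

End Matrices.

(* Main.v *)
Require Import Defs.
From mathcomp Require Import polyrcf ring lra zify.
Set Implicit Arguments.
Unset Strict Implicit.
Import Order.TTheory GRing.Theory Num.Theory.
Local Open Scope classical_set_scope.
Local Open Scope complex_scope.
Local Open Scope ring_scope.
Local Open Scope sesquilinear_scope.

(* D is skew-Hermitian, with kernel spanned by the vector 1, and maps V onto V.
   With y = D x, <x, - A x> and <x, B x> are the sums of sigma |y_j|^2 and of
   (sigma - d_j) |y_j|^2, which bounds W1 and shows that Lambda is real.
   Moreover mu is in Lambda iff, for lambda = (1 - mu) sigma, some nonzero y in V
   has all (lambda - d_j) y_j equal; this holds iff lambda is a root of q', with
   q = prod_j (X - d_j). By Rolle's theorem q' has a root between the two smallest
   and a root between the two largest entries of d. *)

(** * Roots of the derivative of a product of linear factors *)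

Lemma horner_deriv_prod_XsubC (F : fieldType) (I : Type) (r : seq I)
    (a : I -> F) (x : F) :
  all (fun i => x != a i) r ->
  (\prod_(i <- r) ('X - (a i)%:P))^`().[x] =
  (\prod_(i <- r) ('X - (a i)%:P)).[x] * \sum_(i <- r) (x - a i)^-1.
Proof.
elim: r => [|i r IHr] /=; first by rewrite !big_nil derivC horner0 mulr0.
case/andP=> xai /IHr {}IHr.
rewrite !big_cons derivM derivXsubC mul1r hornerD !hornerM IHr hornerXsubC.
by rewrite mulrDr mulrAC divff ?subr_eq0// mul1r mulrA.
Qed.

(* Where q := \prod_i ('X - a i) does not vanish, y is proportional to
   (x - a i)^-1 and its sum to q'(x) / q(x); at x = a k, both sides say that
   a k is a multiple root of q. *)
Lemma root_deriv_prod_XsubC_secular (F : fieldType) (n : nat) (a : 'I_n -> F)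
    (x : F) : (0 < n)%N ->
  (exists y : 'cV[F]_n, [/\ y != 0, \sum_i y i 0 = 0 &
     exists c, forall i, (x - a i) * y i 0 = c]) <->
  root (\prod_i ('X - (a i)%:P))^`() x.
Proof.
move=> n_gt0; have [/forallP xNa|] := boolP [forall i, x != a i].
  have xa i : x - a i != 0 by rewrite subr_eq0.
  rewrite /root horner_deriv_prod_XsubC; last by apply/allP => i _.
  have qx : (\prod_i ('X - (a i)%:P)).[x] != 0.
    by rewrite horner_prod; apply/prodf_neq0 => i _; rewrite hornerXsubC.
  rewrite mulf_eq0 (negPf qx) /=; split=> [[y [y0 sy [c yc]]]|/eqP s0].
    have yE i : y i 0 = c * (x - a i)^-1 by rewrite -(yc i) mulrAC divff// mul1r.
    move: sy; under eq_bigr do rewrite yE.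
    rewrite -mulr_sumr => /eqP; rewrite mulf_eq0 => /orP[/eqP c0|//].
    case/negP: y0; apply/eqP/colP => i.
    by rewrite yE c0 mul0r mxE.
  exists (\col_i (x - a i)^-1); split; last 2 first.
  - by rewrite -[RHS]s0; apply: eq_bigr => i _; rewrite mxE.
  - by exists 1 => i; rewrite mxE divff.
  apply/eqP => /colP/(_ (Ordinal n_gt0))/eqP; rewrite !mxE invr_eq0.
  exact/negP/xa.
rewrite negb_forall => /existsP[k]; rewrite negbK => /eqP ->.
rewrite (bigD1 k)//= rootE derivM derivXsubC mul1r hornerD hornerM hornerXsubC.
rewrite subrr mul0r addr0 horner_prod.
split=> [[y [y0 sy [c yc]]]|/prodf_eq0[j jk]].
  have c0 : c = 0 by rewrite -(yc k) subrr mul0r.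
  apply: contraT => /prodf_neq0 akN.
  have yj j : j != k -> y j 0 = 0.
    move=> jk; have /eqP := yc j; rewrite c0 mulf_eq0.
    by move: (akN j jk); rewrite hornerXsubC => /negPf -> /eqP.
  case/negP: y0; apply/eqP/colP => j; rewrite mxE.
  have [->|/yj//] := eqVneq j k.
  by rewrite -[RHS]sy (bigD1 k)//= big1 ?addr0// => i /yj.
rewrite hornerXsubC subr_eq0 => /eqP akj.
(* Since [a j = a k], this vector is supported where [a k - a i] vanishes, so the common value is
   0. *)
exists (delta_mx k 0 - delta_mx j 0); split.
- apply/eqP => /colP/(_ k)/eqP.
  by rewrite !mxE !eqxx (eq_sym k) (negPf jk) subr0 oner_eq0.
- under eq_bigr do rewrite !mxE eqxx !andbT.
  have sum_delta l : \sum_(i < n) (i == l)%:R = 1 :> F.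
    by rewrite (bigD1 l)//= eqxx big1 ?addr0// => i /negPf ->.
  by rewrite sumrB !sum_delta subrr.
- exists 0 => i; rewrite !mxE eqxx !andbT.
  have [->|ik] := eqVneq i k; first by rewrite subrr mul0r.
  by have [->|ij] := eqVneq i j; rewrite ?akj ?subrr ?mul0r ?mulr0.
Qed.

(** Rolle's theorem if [a < b]; if [a = b], then [a] is a multiple root and so survives in the
    derivative. *)
Lemma root_deriv_prod_XsubC_between (R : rcfType) (s t : seq R) (a b : R) :
  perm_eq s [:: a, b & t] -> a <= b ->
  exists2 c, a <= c <= b & root (\prod_(x <- s) ('X - x%:P))^`() c.
Proof.
move=> st; rewrite (perm_big _ st) /= !big_cons le_eqVlt => /orP[/eqP <-|ab].
  exists a; first by rewrite lexx.
  by rewrite /root !derivM derivXsubC !(hornerE, subrr, mul0r, mulr0).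
have [|c /itvP cab cr] := @poly_rolle _ a b
    (('X - a%:P) * (('X - b%:P) * \prod_(x <- t) ('X - x%:P))) ab.
  by rewrite !hornerM !hornerXsubC !subrr !mul0r mulr0.
by exists c; rewrite ?rootE ?cr// !cab.
Qed.

(** The product is monic, so the top coefficient of its derivative is [size s], which is nonzero in
    characteristic 0. *)
Lemma deriv_prod_XsubC_neq0 (R : numDomainType) (s : seq R) :
  (0 < size s)%N -> (\prod_(x <- s) ('X - x%:P))^`() != 0.
Proof.
move=> s_gt0; apply/eqP => /polyP/(_ (size s).-1)/eqP.
rewrite coef_deriv prednK// coef0.
have -> : (\prod_(x <- s) ('X - x%:P))`_(size s) = 1.
  by rewrite -[RHS](monicP (monic_prod_XsubC s xpredT id)) lead_coefE size_prod_XsubC.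
by rewrite pnatr_eq0 gtn_eqF.
Qed.

(** A nonzero polynomial has finitely many roots. This is what makes the extrema of [Lambda]
    exist. *)
Lemma poly_extremal_roots (R : rcfType) (p : {poly R}) (x : R) :
  p != 0 -> root p x ->
  exists m M, [/\ root p m, root p M & forall y, root p y -> m <= y <= M].
Proof.
move=> p0 px.
have rE y : root p y = (y \in rootsR p).
  by rewrite -(roots_on_rootsR p0) in_itv.
have x_in : x \in rootsR p by rewrite -rE.
(* The given root makes the finite type of roots inhabited, so a least and a greatest element can be
   chosen. *)
pose i0 : seq_sub (rootsR p) := SeqSub x_in.
case: (@arg_minP _ _ _ i0 xpredT (@ssval _ _)) => // m _ mP.
case: (@arg_maxP _ _ _ i0 xpredT (@ssval _ _)) => // M _ MP.
exists (ssval m), (ssval M); split; rewrite ?rE ?ssvalP// => y.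
rewrite rE => y_in; apply/andP; split; first exact: (mP (SeqSub y_in)).
exact: (MP (SeqSub y_in)).
Qed.

(** * Roots of unity and inversion of the Fourier matrix *)

Lemma conjC_real (R : realType) (r : R) : (r%:C)^* = r%:C :> R[i].
Proof. exact: conjc_real. Qed.

Lemma cisD (R : realType) (s t : R) : cis (s + t) = cis s * cis t.
Proof. by rewrite /cis cosD sinD; simpc; rewrite [sin s * _ + _]addrC. Qed.

Lemma cisX (R : realType) (t : R) (m : nat) : cis t ^+ m = cis (t *+ m).
Proof.
elim: m => [|m IHm]; last by rewrite exprS mulrS cisD IHm.
by rewrite expr0 mulr0n /cis cos0 sin0.
Qed.

Lemma conj_cisK (R : realType) (t : R) : cis t * (cis t)^* = 1.
Proof.
rewrite -[(cis t)^*]/(conjc (cis t)) /cis /=; simpc.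
by rewrite -!expr2 cos2Dsin2 mulrC addNr.
Qed.

Lemma cis_neq1 (R : realType) (t : R) : 0 < t < 2 * pi -> cis (- t) != 1.
Proof.
move=> /andP[t0 t2]; rewrite eq_complex /= negb_and; apply/orP; left.
(* Half angle: [cos t = 1 - 2 sin(t/2)^2], which is below 1 as [t/2] lies strictly between 0 and
   [pi]. *)
have : 0 < sin (t / 2) by apply: sin_gt0_pi; apply/andP; split; lra.
have tE : t = (t / 2) *+ 2 by rewrite -mulr_natr divfK.
rewrite cosN {2}tE cos_mulr2n; have := cos2Dsin2 (t / 2).
by move=> cs s0; apply/eqP => c1; nra.
Qed.

Definition omega (R : realType) (N : nat) : R[i] := cis (- (2 * pi / N%:R)).

Lemma omegaN (R : realType) (N : nat) : (0 < N)%N -> omega R N ^+ N = 1.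
Proof.
move=> N_gt0; rewrite cisX -[_ *+ N]mulr_natr mulNr divfK ?pnatr_eq0 -?lt0n//.
rewrite /cis cosN sinN mulr_natl -[pi *+ 2]add0r.
by rewrite cosD2pi sinD2pi cos0 sin0 oppr0.
Qed.

Lemma omegaX_neq1 (R : realType) (N m : nat) :
  (0 < m < N)%N -> omega R N ^+ m != 1.
Proof.
move=> /andP[m0 mN]; have N0 : (0 < N)%N by apply: leq_trans mN.
rewrite cisX mulNrn; apply: cis_neq1.
have N0' : 0 < N%:R :> R by rewrite ltr0n.
rewrite -[_ *+ m]mulr_natr mulrAC; apply/andP; split.
  by rewrite !mulr_gt0 ?invr_gt0 ?pi_gt0 ?ltr0n.
by rewrite ltr_pdivrMr// ltr_pM2l ?ltr_nat// mulr_gt0 ?pi_gt0.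
Qed.

Lemma omega_inj (R : realType) (N : nat) (j k : 'I_N) :
  omega R N ^+ j = omega R N ^+ k -> j = k.
Proof.
have omega0 : omega R N != 0.
  apply/eqP => o0; have /eqP := conj_cisK (- (2 * pi / N%:R) : R).
  by rewrite [cis _]o0 mul0r eq_sym oner_eq0.
have lt_neq (l m : 'I_N) : (l < m)%N -> omega R N ^+ l <> omega R N ^+ m.
  move=> lm olm; have /omegaX_neq1/negP : (0 < m - l < N)%N.
    by rewrite subn_gt0 lm (leq_ltn_trans (leq_subr _ _)).
  apply; apply/eqP/(mulIf (expf_neq0 l omega0)).
  by rewrite mul1r -exprD subnK// ltnW.
move=> jk; case: (ltngtP j k) => [/lt_neq/(_ jk)|/lt_neq/(_ (esym jk))|]//.
exact: val_inj.
Qed.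

(** Entry (j, k) is a geometric sum of ratio [z], an N-th root of unity that equals 1 only when
    [j = k]. *)
Lemma dft_adj (R : realType) (N : nat) :
  (dft N : 'M[R[i]]_N) *m (dft N)^t* = (N%:R)%:M.
Proof.
apply/matrixP => j k; rewrite !mxE.
set z := omega R N ^+ j * (omega R N ^+ k)^*.
under eq_bigr => l _ do
  rewrite !mxE -!/(omega R N) !exprM rmorphXn/= -exprMn -/z.
have kk : omega R N ^+ k * (omega R N ^+ k)^* = 1.
  by rewrite rmorphXn -exprMn /= conj_cisK expr1n.
have [jk|jk] := eqVneq j k.
  under eq_bigr do rewrite /z jk kk expr1n.
  by rewrite sumr_const card_ord mulr1n.
have z1 : z - 1 != 0.
  (* Writing 1 as [omega^k] times its conjugate and cancelling that conjugate turns [z = 1] into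
     [omega^j = omega^k]. *)
  rewrite subr_eq0; apply: contra jk => /eqP; rewrite -kk => /mulIf zk.
  apply/eqP/(@omega_inj R N)/zk; apply/eqP => k0.
  by have /eqP := kk; rewrite k0 mulr0 eq_sym oner_eq0.
(* It suffices that [z - 1] times the sum, which is [z ^+ N - 1], vanishes. *)
apply/eqP; rewrite mulr0n -(mulrI_eq0 _ (mulfI z1)) -subrX1.
rewrite exprMn -rmorphXn -!exprM ![(_ * N)%N]mulnC !exprM.
by rewrite omegaN ?(leq_ltn_trans _ (ltn_ord j))// !expr1n rmorph1 mulr1 subrr.
Qed.

Lemma dft_unit (R : realType) (N : nat) :
  (dft N : 'M[R[i]]_N) \in unitmx.
Proof.
case: N => [|N]; first by rewrite unitmxE det_mx00 unitr1.
have /mulmx1_unit[dU _] : (dft N.+1 : 'M[R[i]]_N.+1) *m (N.+1%:R^-1 *: (dft N.+1)^t*) = 1%:M.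
  by rewrite -scalemxAr dft_adj scale_scalar_mx mulVf ?pnatr_eq0.
exact: dU.
Qed.

Lemma invmx_dft (R : realType) (N : nat) : (0 < N)%N ->
  invmx (dft N : 'M[R[i]]_N) = N%:R^-1 *: (dft N)^t*.
Proof.
move=> N0; apply: (can_inj (mulKmx (dft_unit R N))).
rewrite mulmxV ?dft_unit// -scalemxAr dft_adj scale_scalar_mx mulVf//.
by rewrite pnatr_eq0 -lt0n.
Qed.

(** * Adjoints and skew-Hermitian differentiation *)

Lemma adjmxM (C : numClosedFieldType) (m n p : nat) (A : 'M[C]_(m, n))
    (B : 'M[C]_(n, p)) : (A *m B)^t* = B^t* *m A^t*.
Proof. by rewrite trmx_mul map_mxM. Qed.

Lemma diagC_adj (R : realType) (N : nat) (v : 'rV[R]_N) :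
  (diagC v)^t* = diagC v.
Proof.
apply/matrixP => i j; rewrite !mxE rmorphMn /= conjC_real.
by have [->|ij] := eqVneq i j; rewrite ?eqxx// eq_sym (negPf ij).
Qed.

Lemma innerE (R : realType) (N : nat) (x y : 'cV[R[i]]_N) :
  inner x y = (x^t* *m y) 0 0.
Proof. by rewrite !mxE; apply: eq_bigr => i _; rewrite !mxE. Qed.

Lemma adjmxK (C : numClosedFieldType) (m n : nat) (A : 'M[C]_(m, n)) :
  (A^t*)^t* = A.
Proof. by apply/matrixP => i j; rewrite !mxE conjCK. Qed.

Lemma adjmxZ (C : numClosedFieldType) (m n : nat) (a : C) (A : 'M[C]_(m, n)) :
  (a *: A)^t* = a^* *: A^t*.
Proof. by apply/matrixP => i j; rewrite !mxE rmorphM. Qed.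

(** The inverse of [dft] is its adjoint up to a real factor and [xi] is real, so conjugation only
    changes the sign of ['i]. *)
Lemma specD_adj (R : realType) (N : nat) : (0 < N)%N ->
  (specD N)^t* = - specD N :> 'M[R[i]]_N.
Proof.
move=> N0; rewrite /specD adjmxZ conjCi scaleNr; congr (- (_ *: _)).
rewrite !adjmxM diagC_adj invmx_dft// adjmxZ adjmxK.
by rewrite fmorphV rmorph_nat -!scalemxAl -!scalemxAr mulmxA.
Qed.

Lemma inner_specD (R : realType) (N : nat) (x y : 'cV[R[i]]_N) : (0 < N)%N ->
  inner x (specD N *m y) = - inner (specD N *m x) y.
Proof.
move=> N0; rewrite !innerE adjmxM specD_adj// mulmxN mulNmx mulmxA [in RHS]mxE opprK.
by [].
Qed.

(** * Kernel and range of the differentiation matrix *)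

Lemma xi_eq0 (R : realType) (N : nat) (i : 'I_N) : ~~ odd N ->
  ((xi N : 'rV[R]_N) 0 i == 0) = (i == 0 :> nat).
Proof.
move=> Neven; rewrite mxE; have iN := ltn_ord i.
have pi0 : pi != 0 :> R by rewrite gt_eqF ?pi_gt0.
have two0 : 2 * pi != 0 :> R by rewrite mulf_neq0 ?pnatr_eq0.
have N2 : N = (N./2 + N./2)%N by rewrite addnn even_halfK.
case: ifP => [_|/negbT]; first by rewrite mulf_eq0 (negPf two0) pnatr_eq0.
(* Index 0 cannot reach this branch: [N] is even and positive, so [N./2] is positive ([N = 1] would
   fail). *)
rewrite -leqNgt => Ni; have i0 : (i == 0 :> nat) = false by lia.
case: ifP => _; rewrite i0 mulf_eq0 ?(negPf two0) ?(negPf pi0) ?orbF.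
  by rewrite pnatr_eq0; lia.
by rewrite subr_eq0 eqr_nat ltn_eqF.
Qed.

(** Row 0 of [dft] consists of ones, so [VV] is the space of vectors without zero-frequency
    component. *)
Lemma VV_dft (R : realType) (N : nat) (u : 'cV[R[i]]_N) (i : 'I_N) :
  i = 0 :> nat -> VV u <-> (dft N *m u) i 0 = 0.
Proof.
move=> i0; rewrite -[VV u]/((ones N)^T *m u = 0).
have -> : (dft N *m u) i 0 = ((ones N)^T *m u) 0 0.
  by rewrite !mxE; apply: eq_bigr => j _; rewrite !mxE i0 mul0n expr0.
split=> [->|u0]; first by rewrite mxE.
by apply/matrixP => j k; rewrite !ord1 u0 mxE.
Qed.

Lemma VV_sum (R : realType) (N : nat) (u : 'cV[R[i]]_N) :
  VV u <-> \sum_i u i 0 = 0.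
Proof.
have E : ((ones N)^T *m u) 0 0 = \sum_i u i 0.
  by rewrite mxE; apply: eq_bigr => j _; rewrite !mxE mul1r.
rewrite -[VV u]/((ones N)^T *m u = 0) -E; split=> [->|u0]; first by rewrite mxE.
by apply/matrixP => j k; rewrite !ord1 u0 mxE.
Qed.

Lemma dft_specD (R : realType) (N : nat) (u : 'cV[R[i]]_N) (j : 'I_N) :
  (dft N *m (specD N *m u)) j 0 = 'i * (xi N 0 j)%:C * (dft N *m u) j 0.
Proof.
rewrite /specD -scalemxAl -scalemxAr -!mulmxA mulKVmx ?dft_unit//.
by rewrite mxE /diagC mul_diag_mx !mxE mulrA.
Qed.

Lemma dft_ones (R : realType) (N : nat) (j : 'I_N) :
  (dft N *m ones N) j 0 = if j == 0 :> nat then N%:R else 0 :> R[i].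
Proof.
case: N => [|N] in j *; first by case: j.
(* [ones] is column 0 of the adjoint of [dft], so [dft_adj] gives its transform. *)
have -> : ones N.+1 = (dft N.+1)^t* *m delta_mx 0 0 :> 'cV[R[i]]_N.+1.
  by apply/colP => k; rewrite -colE !mxE mul0n expr0 rmorph1.
rewrite mulmxA dft_adj mul_scalar_mx !mxE eqxx andbT -val_eqE /=.
by case: eqP => _; rewrite ?mulr1 ?mulr0.
Qed.

(** In Fourier coordinates [specD] multiplies by ['i * xi], which vanishes exactly at frequency 0,
    the frequency of [ones]. *)
Lemma specD_eq0 (R : realType) (N : nat) (u : 'cV[R[i]]_N) :
  (0 < N)%N -> ~~ odd N ->
  specD N *m u = 0 <-> exists c, u = c *: ones N.
Proof.
move=> N0 Neven; split=> [Du0|[c ->]]; last first.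
  apply: (can_inj (mulKmx (dft_unit R N))); apply/colP => j.
  rewrite dft_specD mulmx0 [RHS]mxE -scalemxAr [X in _ * X]mxE dft_ones.
  case: eqP => [j0|]; last by rewrite !mulr0.
  by rewrite (eqP (_ : xi N 0 j == 0)) ?xi_eq0 ?j0// mulr0 mul0r.
pose c := (dft N *m u) (Ordinal N0) 0 / N%:R; exists c.
apply: (can_inj (mulKmx (dft_unit R N))); apply/colP => j.
rewrite -scalemxAr [RHS]mxE dft_ones; case: eqP => [j0|/eqP j0].
  rewrite divfK ?pnatr_eq0 -?lt0n//; congr (_ _ 0); exact: val_inj.
have := dft_specD u j; rewrite Du0 mulmx0 mxE mulr0 => /esym/eqP.
rewrite !mulf_eq0 (negPf (neq0Ci _)) /= => /orP[|/eqP//].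
by rewrite eq_complex /= eqxx andbT xi_eq0// (negPf j0).
Qed.

Lemma specD_onto (R : realType) (N : nat) (y : 'cV[R[i]]_N) :
  (0 < N)%N -> ~~ odd N -> VV y -> exists2 v, VV v & specD N *m v = y.
Proof.
move=> N0 Neven Vy.
(* Divide by the Fourier symbol. At frequency 0 the inverse takes its default value, harmlessly,
   because the coefficient of [y] there is 0. *)
pose w : 'cV[R[i]]_N :=
  \col_j (('i * (xi N 0 j)%:C)^-1 * (dft N *m y) j 0).
have dftv : dft N *m (invmx (dft N) *m w) = w by rewrite mulKVmx ?dft_unit.
exists (invmx (dft N) *m w).
  apply/(@VV_dft _ _ _ (Ordinal N0)) => //; rewrite dftv mxE.
  by rewrite (iffLR (VV_dft _ _) Vy)// mulr0.
apply: (can_inj (mulKmx (dft_unit R N))); apply/colP => j.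
rewrite dft_specD dftv [w j 0]mxE.
have [j0|j0] := eqVneq (j : nat) 0%N.
  by rewrite (iffLR (VV_dft _ _) Vy)// !mulr0.
rewrite mulrA divff ?mul1r// mulf_neq0 ?neq0Ci//.
by rewrite eq_complex /= eqxx andbT xi_eq0.
Qed.

Lemma VV_specD (R : realType) (N : nat) (u : 'cV[R[i]]_N) :
  (0 < N)%N -> ~~ odd N -> VV (specD N *m u).
Proof.
move=> N0 Neven; apply/(@VV_dft _ _ _ (Ordinal N0)) => //.
rewrite dft_specD.
by rewrite (eqP (_ : xi N 0 (Ordinal N0) == 0)) ?xi_eq0// mulr0 mul0r.
Qed.

(** * Quadratic forms and bounds on the spectrum *)

Lemma inner_Ah (R : realType) (N : nat) (sigma : R) (x : 'cV[R[i]]_N) :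
  (0 < N)%N ->
  inner x (- Ah N sigma *m x) =
  \sum_j sigma%:C * `|(specD N *m x) j 0| ^+ 2.
Proof.
move=> N0; rewrite /Ah mulNmx -scalemxAl -mulmxA.
rewrite scalemxAr -mulmxN inner_specD// -[RHS]opprK; congr (- _).
rewrite -sumrN; apply: eq_bigr => j _.
by rewrite !mxE normCK; ring.
Qed.

Lemma inner_Bh (R : realType) (N : nat) (sigma : R) (d : R -> R)
    (x : 'cV[R[i]]_N) : (0 < N)%N ->
  inner x (Bh N sigma d *m x) =
  \sum_j (sigma - sample N d 0 j)%:C * `|(specD N *m x) j 0| ^+ 2.
Proof.
move=> N0; rewrite /Bh -!mulmxA inner_specD// -sumrN.
apply: eq_bigr => j _; rewrite /diagC mulmxBl mul_diag_mx mul_scalar_mx.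
rewrite normCK rmorphB /=; set y := specD N *m x.
by rewrite !mxE; ring.
Qed.

(** Both forms are sums over the same [|(specD x)_j|^2], so it is enough to compare weights:
    [sigma - d_j] against [sigma - dmax] and [sigma - dmin]. *)
Lemma Rayleigh_bounds (R : realType) (N : nat) (sigma : R) (d : R -> R)
    (dmin dmax : R) (x : 'cV[R[i]]_N) :
  (0 < N)%N -> 0 < sigma -> (forall j, dmin <= sample N d 0 j <= dmax) ->
  let q := inner x (- Ah N sigma *m x) in
  (1 - sigma^-1 * dmax)%:C * q <= inner x (Bh N sigma d *m x)
    <= (1 - sigma^-1 * dmin)%:C * q.
Proof.
move=> N0 s0 dP /=; rewrite inner_Ah// inner_Bh// !mulr_sumr.
have sE r : (1 - sigma^-1 * r) * sigma = sigma - r by field; rewrite gt_eqF.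
by apply/andP; split; apply: ler_sum => j _; rewrite mulrA -rmorphM /= sE;
  rewrite ler_wpM2r ?exprn_ge0// lecR lerD2l lerN2; case/andP: (dP j).
Qed.

Lemma specD_inj_VV (R : realType) (N : nat) (v : 'cV[R[i]]_N) :
  (0 < N)%N -> ~~ odd N -> VV v -> specD N *m v = 0 -> v = 0.
Proof.
move=> N0 Neven /VV_sum sv /(iffLR (specD_eq0 _ N0 Neven))[c vE].
move: sv; rewrite vE; under eq_bigr do rewrite !mxE mulr1.
rewrite sumr_const card_ord -mulr_natr => /eqP.
by rewrite mulf_eq0 pnatr_eq0 eqn0Ngt N0 orbF => /eqP ->; rewrite scale0r.
Qed.

(** The form is [sigma] times the squared norm of [specD v], and [specD] is injective on [VV]. *)
Lemma inner_Ah_gt0 (R : realType) (N : nat) (sigma : R) (v : 'cV[R[i]]_N) :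
  (0 < N)%N -> ~~ odd N -> 0 < sigma -> VV v -> v != 0 ->
  0 < inner v (- Ah N sigma *m v).
Proof.
move=> N0 Neven s0 Vv; rewrite inner_Ah// -mulr_sumr.
apply: contra_neqT => qN0; apply: specD_inj_VV => //; apply/colP => j.
have s0' : 0 < sigma%:C by rewrite ltcR.
have nn : 0 <= \sum_j `|(specD N *m v) j 0| ^+ 2.
  by apply: sumr_ge0 => k _; rewrite exprn_ge0.
move: qN0; rewrite pmulr_rgt0// lt_def nn andbT negbK psumr_eq0; last first.
  by move=> k _; rewrite exprn_ge0.
move=> /allP/(_ j); rewrite mem_index_enum => /(_ isT).
by rewrite sqrf_eq0 normr_eq0 [RHS]mxE => /eqP.
Qed.

(** Pairing the eigenvalue equation with [v] makes [mu] a Rayleigh quotient with positive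
    denominator. *)
Lemma Lambda_bounds (R : realType) (N : nat) (sigma : R) (d : R -> R)
    (dmin dmax : R) (mu : R[i]) :
  (0 < N)%N -> ~~ odd N -> 0 < sigma ->
  (forall j, dmin <= sample N d 0 j <= dmax) ->
  Lambda (Ah N sigma) (Bh N sigma d) mu ->
  (1 - sigma^-1 * dmax)%:C <= mu <= (1 - sigma^-1 * dmin)%:C.
Proof.
move=> N0 Neven s0 dP [v [Vv v0 Avv]].
have q0 := inner_Ah_gt0 N0 Neven s0 Vv v0.
have := Rayleigh_bounds v N0 s0 dP; rewrite /= -Avv.
have -> : inner v (- mu *: (Ah N sigma *m v)) =
    mu * inner v (- Ah N sigma *m v).
  by rewrite !innerE -scalemxAr mulNmx mulmxN !mxE; ring.
by rewrite !ler_pM2r.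
Qed.

(** * The generalized eigenvalues as roots of a derivative *)

Lemma LambdaP (R : realType) (N : nat) (sigma : R) (d : R -> R) (mu : R[i]) :
  (0 < N)%N -> ~~ odd N ->
  Lambda (Ah N sigma) (Bh N sigma d) mu <->
  root (\prod_j ('X - ((sample N d 0 j)%:C)%:P))^`() ((1 - mu) * sigma%:C).
Proof.
move=> N0 Neven; rewrite -(root_deriv_prod_XsubC_secular _ _ N0).
pose z (v : 'cV[R[i]]_N) : 'cV[R[i]]_N :=
  \col_j (((1 - mu) * sigma%:C - (sample N d 0 j)%:C) * (specD N *m v) j 0).
(* With [y = specD v] and [lambda = (1 - mu) sigma], the pencil factors through [z], whose entries
   are [(lambda - d_j) y_j]; the equation thus says that [specD] kills [z], that is, [z] is
   constant. *)
have pencilE v : Bh N sigma d *m v - (- mu *: (Ah N sigma *m v)) =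
    - (specD N *m z v).
  rewrite /Bh /Ah /z; set D := specD N.
  rewrite -scalemxAl -!mulmxA scalerA scalemxAr -mulmxBr.
  rewrite -mulmxN; congr (_ *m _); apply/colP => j.
  rewrite mulmxBl mul_scalar_mx /diagC mul_diag_mx.
  by set y := D *m v; rewrite !mxE; ring.
split=> [[v [Vv v0 Avv]]|[y [y0 /VV_sum Vy [c yc]]]].
  exists (specD N *m v); split.
  - by apply: contra_neq v0; exact: specD_inj_VV.
  - by apply/VV_sum/VV_specD.
  - have /eqP := pencilE v; rewrite Avv subrr eq_sym oppr_eq0 => /eqP.
    case/(iffLR (specD_eq0 _ N0 Neven)) => c zc; exists c => j.
    by have /colP/(_ j) := zc; rewrite [LHS]mxE !mxE mulr1.
have [v Vv Dv] := specD_onto N0 Neven Vy.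
exists v; split => //; first by apply: contra_neq y0 => v0; rewrite -Dv v0 mulmx0.
apply/esym/eqP; rewrite -subr_eq0 pencilE oppr_eq0; apply/eqP.
apply/(specD_eq0 _ N0 Neven); exists c; apply/colP => j.
by rewrite [LHS]mxE Dv yc !mxE mulr1.
Qed.

(** For real [m] both polynomial and point come from [R], and the embedding into [R[i]] preserves
    and reflects roots; this gives access to Rolle's theorem. *)
Lemma LambdaP_real (R : realType) (N : nat) (sigma : R) (d : R -> R) (m : R) :
  (0 < N)%N -> ~~ odd N ->
  Lambda (Ah N sigma) (Bh N sigma d) m%:C <->
  root (\prod_(x <- entries (sample N d)) ('X - x%:P))^`() ((1 - m) * sigma).
Proof.
move=> N0 Neven; rewrite LambdaP//.
have -> : (1 - m%:C) * sigma%:C = ((1 - m) * sigma)%:C.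
  by rewrite rmorphM rmorphB rmorph1.
have -> : \prod_j ('X - ((sample N d 0 j)%:C)%:P) =
    map_poly (real_complex R) (\prod_(x <- entries (sample N d)) ('X - x%:P)).
  rewrite big_image rmorph_prod; apply: eq_bigr => j _.
  by rewrite rmorphB /= map_polyX map_polyC.
by rewrite deriv_map fmorph_root.
Qed.

(** * Grid values and the final bounds *)

Lemma sample_itv (R : realType) (N : nat) (d : R -> R) (dmin dmax : R) :
  is_min (d @` [set` `[0, 1]]) dmin -> is_max (d @` [set` `[0, 1]]) dmax ->
  forall j, dmin <= sample N d 0 j <= dmax.
Proof.
move=> [_ dminP] [_ dmaxP] j; rewrite mxE.
have N0 : (0 < N)%N by apply: leq_ltn_trans (ltn_ord j).
have dj : (d @` [set` `[0, 1]]) (d (grid j)).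
  exists (grid j) => //=; rewrite in_itv /= divr_ge0//.
  by rewrite ler_pdivrMr ?ltr0n// mul1r ler_nat ltn_ord.
by rewrite dminP ?dmaxP.
Qed.

Theorem proposition6p1 (R : realType) (N : nat) (sigma : R) (d : R -> R)
    (dmin dmax : R)
    (N_ge2 : (2 <= N)%N) (N_even : ~~ odd N)
    (sigma_gt0 : 0 < sigma)
    (d_periodic : periodic d 1)
    (d_gt0 : forall x : R, 0 < d x)
    (d_min : is_min (d @` [set` `[0, 1]]) dmin)
    (d_max : is_max (d @` [set` `[0, 1]]) dmax) :
  let A : 'M[R[i]]_N := Ah N sigma in
  let B : 'M[R[i]]_N := Bh N sigma d in
  let d2min : R := second_smallest (entries (sample N d)) in
  let d2max : R := second_largest (entries (sample N d)) in
  (forall w : R[i], W1 A B w ->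
     w \is Num.real /\
     (1 - sigma^-1 * dmax)%:C <= w <= (1 - sigma^-1 * dmin)%:C) /\
  ((forall mu : R[i], Lambda A B mu -> mu \is Num.real) /\
   exists mu_min mu_max : R,
     [/\ is_min (Lambda A B) mu_min%:C,
         is_max (Lambda A B) mu_max%:C,
         1 - sigma^-1 * dmax <= mu_min <= 1 - sigma^-1 * d2max &
         1 - sigma^-1 * d2min <= mu_max <= 1 - sigma^-1 * dmin]).
Proof.
move=> A B d2min d2max.
have N0 : (0 < N)%N by apply: leq_trans N_ge2.
have dP := sample_itv (N := N) d_min d_max.
(* In the partial order of [R[i]], being comparable to a real number already forces [z] to be
   real. *)
have realP (z : R[i]) (a b : R) : a%:C <= z <= b%:C -> z \is Num.real.
  move=> /andP[az _]; rewrite -(subrK a%:C z); apply: rpredD.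
    by rewrite ger0_real ?subr_ge0.
  by apply/complex_realP; exists a.
split=> [w [x [Vx qx] <-]|].
  have := Rayleigh_bounds x N0 sigma_gt0 dP; rewrite /= -/A -/B qx !mulr1.
  by move=> wP; split => //; exact: realP wP.
have bounds mu : Lambda A B mu ->
    (1 - sigma^-1 * dmax)%:C <= mu <= (1 - sigma^-1 * dmin)%:C.
  exact: Lambda_bounds.
split=> [mu /bounds/realP//|].
set s := entries (sample N d) in d2min d2max *.
have s_size : size s = N by rewrite size_map size_enum_ord.
(* Stated for any relation so as to serve both the ascending and the descending sort; [N >= 2]
   provides the two leading entries. *)
have split_sort (leT : rel R) : exists t,
    perm_eq s [:: nth 0 (sort leT s) 0, nth 0 (sort leT s) 1 & t].
  have : perm_eq s (sort leT s) by rewrite perm_sym perm_sort.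
  have := size_sort leT s; rewrite s_size.
  case: (sort leT s) => [|x [|y t]] /= Ns; [lia|lia|by exists t].
have [t st] := split_sort <=%R.
have lemin : nth 0 (sort <=%R s) 0 <= d2min.
  apply: (le_sorted_leq_nth 0 (sort_le_sorted s));
    by rewrite ?inE ?size_sort ?s_size// ltnW.
have [cmin /andP[_ cminle] cminr] := root_deriv_prod_XsubC_between st lemin.
have [t' st'] := split_sort >=%R.
have gemax : d2max <= nth 0 (sort >=%R s) 0.
  have ge_total : total (>=%R : rel R) by move=> x y; exact: le_total.
  have ge_trans : transitive (>=%R : rel R) by move=> x y z /[swap]; exact: le_trans.
  apply: (sorted_leq_nth ge_trans (@lexx _ _) 0 (sort_sorted ge_total s));
    by rewrite ?inE ?size_sort ?s_size.
(* The descending sort lists the largest entry first; the two are swapped to match the order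
   [a <= b] of the Rolle lemma. *)
have st'' : perm_eq s [:: d2max, nth 0 (sort >=%R s) 0 & t'].
  by apply: perm_trans st' _; apply/permP => P /=; rewrite addnCA.
have [cmax /andP[cmaxge _] cmaxr] := root_deriv_prod_XsubC_between st'' gemax.
have q'0 : (\prod_(x <- s) ('X - x%:P))^`() != 0.
  by rewrite deriv_prod_XsubC_neq0// s_size.
have [m [M [mr Mr mMP]]] := poly_extremal_roots q'0 cminr.
have s_neq0 : sigma != 0 by rewrite gt_eqF.
have LamP c : root (\prod_(x <- s) ('X - x%:P))^`() c ->
    Lambda A B (1 - sigma^-1 * c)%:C.
  move=> cr; apply/LambdaP_real => //.
  by rewrite (_ : _ * sigma = c)//; field.
(* The passage from roots to eigenvalues is decreasing, so the largest root [M] yields [mu_min] and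
   the smallest root [m] yields [mu_max]. *)
have le_mu a b : (1 - sigma^-1 * a <= 1 - sigma^-1 * b) = (b <= a).
  by rewrite lerD2l lerN2 ler_pM2l// invr_gt0.
have muP mu : Lambda A B mu ->
    (1 - sigma^-1 * M)%:C <= mu <= (1 - sigma^-1 * m)%:C.
  move=> Lmu; have /bounds/realP/complex_realP[k kE] := Lmu.
  move: Lmu; rewrite {mu}kE.
  move=> /(iffLR (LambdaP_real _ _ _ N0 N_even))/mMP.
  have kE : k = 1 - sigma^-1 * ((1 - k) * sigma) by field.
  by rewrite [in X in _ -> X]kE !lecR !le_mu andbC.
exists (1 - sigma^-1 * M), (1 - sigma^-1 * m); split.
- by split=> [|mu /muP/andP[]//]; exact: LamP.
- by split=> [|mu /muP/andP[]//]; exact: LamP.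
- have /andP[+ _] := bounds _ (LamP _ Mr); rewrite lecR => ->.
  (* The chain is [d2max <= cmax <= M]. *)
  by rewrite le_mu; have /andP[_] := mMP _ cmaxr; exact: le_trans.
- have /andP[_ +] := bounds _ (LamP _ mr); rewrite lecR => ->.
  (* The chain is [m <= cmin <= d2min]. *)
  rewrite le_mu andbT; have /andP[+ _] := mMP _ cminr => /le_trans; exact.
Qed.
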